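(* Fix a constant $C$. Suppose there is a universal core algorithm with parameters $\epsilon=\Omega(1/\log^k(nN))$ (for any constant $k\ge 0$), $\delta=\Omega(1/\log^u(nN))$ (for any constant $u\ge0$), $\alpha=1$, and $\mathcal{G}=\mathcal{U}(C)$, which makes a single pass over the stream $D$ and uses memory polylogarithmic in $n$ and $N$. Then there is a universal sum algorithm with parameters $\epsilon=\Omega(1/\log^k(nN))$ (for any constant $k\ge0$), $\delta=0.3$, and $\mathcal{G}=\mathcal{U}(C)$, which uses space polylogarithmic in $n$ and $N$ and makes a single pass over $D$.
   Context: Streaming model: the universe is $[n]=\{1,\ldots,n\}$, and $N$ is an integer. A stream $D(n,N)$ is a sequence of elements of $[n]$ arriving over discrete time steps. The model is the timestamp-based sliding window model: any number of elements may arrive or expire per time step. The current window $W$ consists of the most recent (active) elements, and $N$ bounds the window size. The frequency vector is $M(W)=(m_1,\ldots,m_n)$, where $m_i$ is the number of active occurrences of $i$. Heavy elements: for a vector $V$, index $i$ is $(G,\alpha)$-heavy if $G(v_i)>\alpha\sum_{j\ne i}G(v_j)$. Local jump: for $\epsilon>0$ and $x\in\mathbb{N}$, $\pi_\epsilon(x)=\min\{x,\ \min\{z\in\mathbb{N}: G(x+z)>(1+\epsilon)G(x)\text{ or }G(x-z)<(1-\epsilon)G(x)\}\}$. The class $\mathcal{U}(C)$: all non-decreasing $G:\mathbb{R}\to\mathbb{R}$ with $G(0)=0$ and $G(1)>0$ satisfying both of the following. (i) For every $k$ there exist $N_0$ and $t\le C$ such that for all $x,y\in\mathbb{N}^+$,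 $R\in\mathbb{R}^+$ and $\epsilon$: if $R>N_0$, $G(x)/G(y)=R$ and $\epsilon>1/\log^k(Rx)$, then $(\pi_\epsilon(x)/y)^2\ge R/\log^t(Rx)$. (ii) For every $k$ there exist $r\le C$ and $N_1$ such that for all $x\ge N_1$ and all $\epsilon>1/\log^k(x)$, we have $\pi_\epsilon(x)\ge x/\log^r(x)$. Universal core structure: let $V=(v_1,\ldots,v_n)$ be a fixed vector. A data structure $S$ is a universal core structure with parameters $\epsilon,\delta,\alpha>0$ and class $\mathcal{G}$ if the following holds. Given any $G\in\mathcal{G}$ (not known in advance), $S$ outputs a set $T=\{(x_1,j_1),\ldots,(x_\ell,j_\ell)\}$ such that, with probability at least $1-\delta$: (1) $(1-\epsilon)G(v_{j_i})\le x_i\le(1+\epsilon)G(v_{j_i})$ for each $i$; (2) if some $v_i$ is $(G,\alpha)$-heavy with respect to $V$, then $i\in\{j_1,\ldots,j_\ell\}$. A universal core algorithm, given any stream $D(n,N)$, outputs a universal core structure for $M(W)$ with the same parameters. Universal sum structure: given any $G\in\mathcal{G}$, it outputs $x$ such that, with probability at least $1-\delta$, $(1-\epsilon)\sum_iG(v_i)\le x\le(1+\epsilon)\sum_iG(v_i)$. A universal sum algorithm, given any stream, outputs a universal sum structure for $M(W)$ with the same parameters. *)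

(* Defs.v *)
(* MathComp / MathComp-Analysis *)
From mathcomp Require Import all_boot all_order all_algebra.
From mathcomp Require Import classical_sets reals exp.

Set Implicit Arguments.
Unset Strict Implicit.
Unset Printing Implicit Defensive.

Import Order.TTheory GRing.Theory Num.Theory.
Local Open Scope ring_scope.

Definition log2 {R : realType} (x : R) : R := ln x / ln 2.

(** * Timestamp-based sliding windows *)

(* The universe [n] is 'I_n. A stream is the list of its time steps up to the
   present, each holding the (possibly empty) list of elements that arrive
   during it. *)
Definition stream (n : nat) := seq (seq 'I_n).

(* An element is active during the [tau] time steps that start with the one in
   which it arrives. *)
Definition window (tau n : nat) (D : stream n) : seq 'I_n :=
  flatten (drop (size D - tau) D).

(* N bounds the number of active elements at every moment of the stream. *)
Definition bounded_window (tau n N : nat) (D : stream n) : Prop :=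
  forall t : nat, (size (window tau (take t D)) <= N)%N.

Definition freq {R : realType} (n : nat) (W : seq 'I_n) : 'rV[R]_n :=
  \row_i (count_mem i W)%:R.

(** * One-pass randomized algorithms *)

(* [Some i] is the arrival of i, [None] is the end of a time step. *)
Definition events (n : nat) (D : stream n) : seq (option 'I_n) :=
  flatten [seq rcons (map Some b) None | b <- D].

(* A single-pass algorithm is a finite-state machine that reads the events in
   order and draws a fresh, independent, uniform coin for its initialization,
   for each event and for the query. Only the state persists, and the query
   ([Q]) is not available before the stream has been read. *)
Record algorithm (n : nat) (Q A : Type) := Algorithm {
  state : finType;
  coin : finType;
  coin_gt0 : (0 < #|coin|)%N;
  init : coin -> state;
  update : coin -> state -> option 'I_n -> state;
  answer : coin -> state -> Q -> A
}.

Definition memory_bits (n : nat) (Q A : Type) (M : algorithm n Q A) : nat :=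
  up_log 2 #|state M|.

Definition tape (n : nat) (Q A : Type) (M : algorithm n Q A) (D : stream n) :
    finType :=
  (coin M * (size (events D)).-tuple (coin M) * coin M)%type.

Definition final_state (n : nat) (Q A : Type) (M : algorithm n Q A)
    (D : stream n) (w : tape M D) : state M :=
  foldl (fun s ce => update ce.1 s ce.2) (init w.1.1) (zip w.1.2 (events D)).

Definition output (n : nat) (Q A : Type) (M : algorithm n Q A)
    (D : stream n) (w : tape M D) (q : Q) : A :=
  answer w.2 (final_state w) q.

Definition Pr {R : realType} (Omega : finType) (E : pred Omega) : R :=
  #|E|%:R / #|Omega|%:R.

(** * The class U(C) *)

Definition jump {R : realType} (G : R -> R) (eps : R) (x z : nat) : bool :=
  ((1 + eps) * G x%:R < G (x%:R + z%:R)) ||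
  (G (x%:R - z%:R) < (1 - eps) * G x%:R).

(* min {x, min {z | jump G eps x z}}: the z >= x cannot lower the minimum. *)
Definition local_jump {R : realType} (G : R -> R) (eps : R) (x : nat) : nat :=
  \big[minn/x]_(z < x | jump G eps x z) z.

Definition jump_growth {R : realType} (C : R) (G : R -> R) : Prop :=
  forall k : R, exists (N0 : nat) (t : R), t <= C /\
  forall (x y : nat) (r eps : R), (0 < x)%N -> (0 < y)%N -> 0 < r ->
    N0%:R < r -> G x%:R / G y%:R = r -> (log2 (r * x%:R) `^ k)^-1 < eps ->
    r / log2 (r * x%:R) `^ t <= ((local_jump G eps x)%:R / y%:R) ^+ 2.

Definition jump_large {R : realType} (C : R) (G : R -> R) : Prop :=
  forall k : R, exists (r : R) (N1 : nat), r <= C /\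
  forall (x : nat) (eps : R), (N1 <= x)%N -> (log2 x%:R `^ k)^-1 < eps ->
    x%:R / log2 x%:R `^ r <= (local_jump G eps x)%:R.

Definition classU {R : realType} (C : R) : set (R -> R) :=
  [set G | {homo G : x y / x <= y} /\ G 0 = 0 /\ 0 < G 1 /\
           jump_growth C G /\ jump_large C G].

(* The constants N0 and N1 above depend on G, so U(C) does not restrict G on a
   bounded range: for 0 < C, every non-decreasing G with G 0 = 0 < G 1 agrees on
   [0, N] with a member of U(C), one that is constant further on. Guarantees
   for all G in U(C) with memory polylogarithmic in n and N are therefore
   asymptotic in n N for each G separately: the guarantee for G is in force once
   m G <= n N. The constant threshold m = 0 gives back U(C). *)
Definition classU_from {R : realType} (C : R) (m : (R -> R) -> nat)
    (n N : nat) : set (R -> R) :=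
  [set G | classU C G /\ (m G <= n * N)%N].

(** * Universal structures and algorithms *)

Definition heavy {R : realType} (n : nat) (G : R -> R) (alpha : R)
    (V : 'rV[R]_n) (i : 'I_n) : bool :=
  alpha * (\sum_(j | j != i) G (V 0 j)) < G (V 0 i).

Definition approx {R : realType} (eps y x : R) : bool :=
  (1 - eps) * y <= x <= (1 + eps) * y.

Definition core_ok {R : realType} (n : nat) (eps alpha : R) (G : R -> R)
    (V : 'rV[R]_n) (T : seq (R * 'I_n)) : bool :=
  all (fun p => approx eps (G (V 0 p.2)) p.1) T &&
  [forall i, heavy G alpha V i ==> (i \in unzip2 T)].

Definition sum_ok {R : realType} (n : nat) (eps : R) (G : R -> R)
    (V : 'rV[R]_n) (x : R) : bool :=
  approx eps (\sum_i G (V 0 i)) x.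

(* A randomized data structure is given by its answers, as a function of its
   random choices and of the query G. The function G is quantified outside of
   the probability. *)
Definition universal_core {R : realType} (n : nat) (eps delta alpha : R)
    (calG : set (R -> R)) (V : 'rV[R]_n) (Omega : finType)
    (S : Omega -> (R -> R) -> seq (R * 'I_n)) : Prop :=
  forall G, calG G ->
    1 - delta <= Pr (fun w => core_ok eps alpha G V (S w G)).

Definition universal_sum {R : realType} (n : nat) (eps delta : R)
    (calG : set (R -> R)) (V : 'rV[R]_n) (Omega : finType)
    (S : Omega -> (R -> R) -> R) : Prop :=
  forall G, calG G -> 1 - delta <= Pr (fun w => sum_ok eps G V (S w G)).

Definition universal_core_algorithm {R : realType} (tau n N : nat)
    (eps delta alpha : R) (calG : set (R -> R))
    (M : algorithm n (R -> R) (seq (R * 'I_n))) : Prop :=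
  forall D : stream n, bounded_window tau N D ->
    universal_core eps delta alpha calG (freq (window tau D)) (@output _ _ _ M D).

Definition universal_sum_algorithm {R : realType} (tau n N : nat)
    (eps delta : R) (calG : set (R -> R))
    (M : algorithm n (R -> R) R) : Prop :=
  forall D : stream n, bounded_window tau N D ->
    universal_sum eps delta calG (freq (window tau D)) (@output _ _ _ M D).

(** * Asymptotics in n and N *)

(* A positive f with f = Omega (1 / log^k (n N)). Since f is positive and only
   finitely many (n, N) have n N < m, the usual threshold m is not needed.
   When n N = 1 and k > 0 the bound reads 0 <= f n N. *)
Definition Omega_inv_log {R : realType} (k : R) (f : nat -> nat -> R) : Prop :=
  (forall n N : nat, (0 < n)%N -> (0 < N)%N -> 0 < f n N) /\
  exists2 c : R, 0 < c & forall n N : nat, (0 < n)%N -> (0 < N)%N ->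
    c / log2 (n * N)%:R `^ k <= f n N.

Definition polylog {R : realType} (f : nat -> nat -> nat) : Prop :=
  exists (c : R) (d : nat), forall n N : nat, (0 < n)%N -> (0 < N)%N ->
    (f n N)%:R <= c * (1 + log2 (n * N)%:R) ^+ d.

(* Main.v *)
(* Recursive sketching (Braverman-Ostrovsky, after Indyk-Woodruff), analysed in
   L1. Write f_j = G(m_j), S(D) = sum_{j in D} f_j, and let sgn_j be pairwise
   independent uniform signs. Keeping the j in D with sgn_j = 1 gives a random
   D' with, for any values x_j,
     2 S(D') - sum_{j in D} sgn_j x_j = S(D) + sum_{j in D} sgn_j (f_j - x_j),
   so an estimate of S(D') yields one of S(D) whose new error has second moment
   sum_j (f_j - x_j)^2. The x_j come from hashing D into 2^b buckets and running
   one core algorithm on the substream of each bucket: either x_j is accurate,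
   or x_j = 0 and f_j is at most the sum of the f_i that collide with j, so that
   on average over the hashing sum_j (f_j - x_j)^2 <= (e^2 + 2^-b) S(D)^2. As
   E S(D') = S(D) / 2, the L1 errors of the levels just add up. After log n + 4
   levels no element is left, except with probability 1/10, and the estimate 0
   is exact; the core algorithms all succeed, except with probability 1/10, and
   Markov's inequality costs another 1/10. *)
Require Import Defs.
From mathcomp Require Import all_boot all_order all_algebra.
From mathcomp Require Import classical_sets reals exp.
From mathcomp Require Import lra.

Set Implicit Arguments.
Unset Strict Implicit.
Unset Printing Implicit Defensive.

Import Order.TTheory GRing.Theory Num.Theory.
Local Open Scope ring_scope.

(** * Averages over finite types *)

Section Average.

Variable R : realType.

Definition avg (T : finType) (F : T -> R) : R := (\sum_x F x) / #|T|%:R.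

Lemma Pr_avg (T : finType) (E : pred T) : Pr E = avg (fun x => (E x)%:R).
Proof.
by rewrite /Pr /avg -sum1_card natr_sum big_mkcond; congr (_ / _);
  apply: eq_bigr => x _; rewrite unfold_in; case: (E x).
Qed.

Lemma eq_avg (T : finType) (F G : T -> R) : F =1 G -> avg F = avg G.
Proof. by move=> FG; congr (_ / _); apply: eq_bigr. Qed.

Lemma ler_avg (T : finType) (F G : T -> R) :
  (forall x, F x <= G x) -> avg F <= avg G.
Proof. by move=> FG; rewrite ler_wpM2r ?invr_ge0 ?ler0n//; apply: ler_sum. Qed.

Lemma avgD (T : finType) (F G : T -> R) :
  avg (fun x => F x + G x) = avg F + avg G.
Proof. by rewrite /avg big_split mulrDl. Qed.

Lemma avgZ (T : finType) (c : R) (F : T -> R) :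
  avg (fun x => c * F x) = c * avg F.
Proof. by rewrite /avg -mulr_sumr mulrA. Qed.

Lemma avg_sum (T I : finType) (P : pred I) (F : I -> T -> R) :
  avg (fun x => \sum_(i | P i) F i x) = \sum_(i | P i) avg (F i).
Proof. by rewrite /avg exchange_big mulr_suml. Qed.

Lemma avg_cst (T : finType) (c : R) : (0 < #|T|)%N -> avg (fun _ : T => c) = c.
Proof.
move=> T0; rewrite /avg sumr_const -[c *+ _]mulr_natr.
by rewrite mulfK// pnatr_eq0 -lt0n.
Qed.

Lemma avg_pair (T U : finType) (F : T * U -> R) :
  avg F = avg (fun x => avg (fun y => F (x, y))).
Proof.
rewrite /avg -mulr_suml (pair_big predT predT (fun x y => F (x, y)))/=.
rewrite card_prod natrM invfM -mulrA [X in _ = _ * X]mulrC; congr (_ * _).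
by apply: eq_bigr => -[].
Qed.

Lemma avg_swap (T U : finType) (F : T -> U -> R) :
  avg (fun x => avg (F x)) = avg (fun y => avg (F^~ y)).
Proof. by rewrite /avg -!mulr_suml exchange_big mulrAC. Qed.

Lemma avg_bij (T U : finType) (h : T -> U) (F : U -> R) :
  bijective h -> avg F = avg (fun x => F (h x)).
Proof.
move=> bh; rewrite /avg (bij_eq_card bh); congr (_ / _).
exact: (reindex h (onW_bij _ bh)).
Qed.

Lemma avg_tuple0 (T : finType) (F : 0.-tuple T -> R) : avg F = F [tuple].
Proof.
rewrite (eq_avg (G := fun=> F [tuple])) ?avg_cst ?card_tuple ?expn0// => t.
by rewrite tuple0.
Qed.

Lemma avg_tupleS (T : finType) m (F : m.+1.-tuple T -> R) :
  avg F = avg (fun x => avg (fun t : m.-tuple T => F (cons_tuple x t))).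
Proof.
rewrite (@avg_bij (T * m.-tuple T)%type _ (fun p => cons_tuple p.1 p.2)).
  by rewrite avg_pair.
exists (fun t => (thead t, behead_tuple t)).
  by case=> x t; rewrite /= theadE; congr (_, _); apply: val_inj.
by move=> t; apply: val_inj; rewrite [t in RHS]tuple_eta.
Qed.

(** Independence of the coordinates of a uniform function: expanding the product of sums turns it
    into a sum over all functions. *)
Lemma avg_ffun_prod (I T : finType) (F : I -> T -> R) :
  avg (fun f : {ffun I -> T} => \prod_i F i (f i)) = \prod_i avg (F i).
Proof.
rewrite /avg -bigA_distr_bigA big_split/= card_ffun natrX prodr_const exprVn.
by congr (_ * _); rewrite -[#|xpredT|]/#|I|.
Qed.

(** One coordinate of a uniform function is uniform: multiply by the factor 1 at all other
    coordinates and factorize. *)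
Lemma avg_ffun1 (I T : finType) (i : I) (F : T -> R) : (0 < #|T|)%N ->
  avg (fun f : {ffun I -> T} => F (f i)) = avg F.
Proof.
move=> T0; pose H k x := if k == i then F x else 1.
have HE (f : {ffun I -> T}) : F (f i) = \prod_k H k (f k).
  rewrite (bigD1 i)//= big1 ?mulr1 /H ?eqxx// => k /negbTE ki.
  by rewrite ki.
rewrite (eq_avg HE) avg_ffun_prod (bigD1 i)//= big1 ?mulr1.
  by apply: eq_avg => x; rewrite /H eqxx.
by move=> k /negbTE ki; rewrite /H ki avg_cst.
Qed.

Lemma Pr_predC (T : finType) (E : pred T) : (0 < #|T|)%N ->
  Pr E = 1 - avg (fun x => (~~ E x)%:R).
Proof.
move=> T0; rewrite Pr_avg -[X in X - _](avg_cst 1 T0).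
apply/eqP; rewrite eq_sym subr_eq -avgD; apply/eqP/eq_avg => x.
by case: (E x); rewrite ?addr0 ?add0r.
Qed.

(** Markov's inequality in a multiplied form that also covers [a = 0]: the bound then forces [F] to
    vanish everywhere. This happens for a window on which all values of [G] are 0. *)
Lemma avg_markov (T : finType) (F : T -> R) (a t : R) : (0 < #|T|)%N ->
  0 <= a -> 0 <= t -> avg (fun x => `|F x|) <= t * a ->
  avg (fun x => (a < `|F x|)%R%:R) <= t.
Proof.
move=> T0 a0 t0 Ft; have [a_eq0|a_neq0] := eqVneq a 0.
  have F0 x : `|F x| = 0.
    move: Ft; rewrite a_eq0 mulr0 pmulr_lle0 ?invr_gt0 ?ltr0n// => F_le0.
    by apply: (psumr_eq0P (P := xpredT) (F := fun x => `|F x|)) => //;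
      apply/eqP; rewrite eq_le F_le0 sumr_ge0.
  by rewrite (eq_avg (G := fun=> 0)) ?avg_cst// => x; rewrite F0 a_eq0 ltxx.
have a_gt0 : 0 < a by rewrite lt_def a_neq0.
rewrite -(ler_pM2r a_gt0); apply: le_trans Ft; rewrite mulrC -avgZ.
by apply: ler_avg => x; case: ltP => [/ltW|_]; rewrite ?mulr1 ?mulr0.
Qed.

End Average.

(** * Pairwise independent hashing *)

Definition seed (w : nat) : finType := (bool * {ffun 'I_w -> bool})%type.

Lemma card_seed w : #|seed w| = (2 ^ w.+1)%N.
Proof. by rewrite card_prod card_bool card_ffun card_bool card_ord expnS. Qed.

Lemma card_seed_gt0 w : (0 < #|seed w|)%N.
Proof. by rewrite card_seed expn_gt0. Qed.

(** An arbitrary labelling by [w]-bit vectors, injective once [n <= 2 ^ w]; the default of [nth] is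
    only reached when there are too few vectors. *)
Definition code (n w : nat) (j : 'I_n) : {ffun 'I_w -> bool} :=
  nth [ffun=> false] (enum {ffun 'I_w -> bool}) j.

Lemma code_inj n w : (n <= 2 ^ w)%N -> injective (@code n w).
Proof.
move=> nw i j /eqP; rewrite nth_uniq ?enum_uniq// -?cardE ?card_ffun ?card_bool
  ?card_ord; first by move/eqP/val_inj.
all: exact: leq_trans (ltn_ord _) nw.
Qed.

(* A random affine form over F_2, hence pairwise independence in j. *)
Definition flip (n w : nat) (s : seed w) (j : 'I_n) : bool :=
  s.1 (+) \big[addb/false]_k (s.2 k && code w j k).

Definition subsample (n w : nat) (D : {set 'I_n}) (s : seed w) : {set 'I_n} :=
  [set j in D | ~~ flip s j].

Definition hash (n w b : nat) (h : {ffun 'I_b -> seed w}) (j : 'I_n) :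
  {ffun 'I_b -> bool} := [ffun k => flip (h k) j].

Section Hashing.

Variables (R : realType) (n w : nat).

Definition sgn (s : seed w) (j : 'I_n) : R := (-1) ^+ flip s j.

Lemma sgn_sqr s j : sgn s j * sgn s j = 1.
Proof. by rewrite /sgn; case: flip; rewrite ?expr0 ?expr1 ?mulrNN mulr1. Qed.

Lemma sgnE s j :
  sgn s j = (-1) ^+ s.1 * \prod_k (-1) ^+ (s.2 k && code w j k).
Proof.
rewrite /sgn /flip signr_addb; congr (_ * _).
by apply: (big_morph (fun b : bool => (-1) ^+ b : R)) => // x y;
  rewrite signr_addb.
Qed.

Lemma avg_sgn j : avg (sgn^~ j) = 0.
Proof.
(* Averaging over the constant bit [s.1] first already gives 0. *)
rewrite (eq_avg (sgnE^~ j)) avg_pair avg_swap.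
rewrite (eq_avg (G := fun=> 0)) ?avg_cst ?card_ffun ?card_bool ?expn_gt0// => t.
by rewrite /avg big_bool /= expr1 expr0 -mulrDl addNr mul0r mul0r.
Qed.

(** Pairwise independence. The constant bits cancel in the product of two signs, and at a coordinate
    [k] where the codes differ the remaining factor is a uniform sign. *)
Lemma avg_sgn2 i j : (n <= 2 ^ w)%N ->
  avg (fun s => sgn s i * sgn s j) = (i == j)%:R.
Proof.
move=> nw; have [->|ij] := eqVneq i j.
  by rewrite (eq_avg (sgn_sqr^~ j)) avg_cst ?card_seed_gt0.
pose H k (x : bool) : R := (-1) ^+ (x && (code w i k (+) code w j k)).
have HE s : sgn s i * sgn s j = \prod_k H k (s.2 k).
  rewrite !sgnE mulrACA -signr_addb addbb mul1r -big_split/=.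
  by apply: eq_bigr => k _; rewrite -signr_addb /H; case: (s.2 k).
have [k ijk] : exists k, code w i k != code w j k.
  apply/existsP; apply: contraNT ij; rewrite negb_exists => /forallP eqc.
  apply/eqP/(code_inj nw)/ffunP => k; apply/eqP; have := eqc k.
  by rewrite negbK.
rewrite (eq_avg HE) avg_pair /= avg_cst ?card_bool// avg_ffun_prod (bigD1 k)//=.
rewrite /avg big_bool /H /= -negb_eqb ijk.
by rewrite expr1 expr0 addNr !mul0r.
Qed.

Lemma sum_subsample (D : {set 'I_n}) s (f : 'I_n -> R) :
  2 * (\sum_(j in subsample D s) f j) = \sum_(j in D) (f j + sgn s j * f j).
Proof.
rewrite big_mkcond mulr_sumr [RHS]big_mkcond; apply: eq_bigr => j _.
rewrite inE; case: (j \in D) => /=; last by rewrite mulr0.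
by rewrite /sgn; case: flip => /=; rewrite ?expr1 ?expr0; lra.
Qed.

Lemma avg_sum_subsample (D : {set 'I_n}) (f : 'I_n -> R) :
  2 * avg (fun s : seed w => \sum_(j in subsample D s) f j) = \sum_(j in D) f j.
Proof.
rewrite -avgZ (eq_avg (fun s => sum_subsample D s f)) avg_sum.
apply: eq_bigr => j _; rewrite avgD avg_cst ?card_seed_gt0//.
under eq_avg do rewrite mulrC.
by rewrite avgZ avg_sgn mulr0 addr0.
Qed.

Lemma avg_sgn_sum_sqr (D : {set 'I_n}) (r : 'I_n -> R) : (n <= 2 ^ w)%N ->
  avg (fun s => (\sum_(j in D) sgn s j * r j) ^+ 2) = \sum_(j in D) r j ^+ 2.
Proof.
move=> nw.
under eq_avg do rewrite expr2 big_distrlr/=.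
rewrite avg_sum; apply: eq_bigr => i iD; rewrite avg_sum (bigD1 i)//= big1.
  rewrite addr0; under eq_avg do rewrite mulrACA mulrC.
  by rewrite avgZ avg_sgn2// eqxx mulr1 expr2.
move=> j /andP[_ /negbTE ji]; under eq_avg do rewrite mulrACA mulrC.
by rewrite avgZ avg_sgn2// eq_sym ji mulr0.
Qed.

(** Each of the [b] independent bits agrees on [i] and [j] with probability 1/2, since the indicator
    of agreement is [(1 + sgn s i * sgn s j) / 2]. *)
Lemma hash_collision b (i j : 'I_n) : (n <= 2 ^ w)%N -> i != j ->
  avg (fun h : {ffun 'I_b -> seed w} => (hash h i == hash h j)%:R : R)
  = (2 ^+ b)^-1.
Proof.
move=> nw ij.
pose H (s : seed w) : R := (flip s i == flip s j)%:R.
have HE (h : {ffun 'I_b -> seed w}) :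
    (hash h i == hash h j)%:R = \prod_k H (h k) :> R.
  have [eqh|] := eqVneq (hash h i) (hash h j).
    rewrite big1// => k _; rewrite /H.
    by have /ffunP/(_ k) := eqh; rewrite !ffunE => ->; rewrite eqxx.
  move=> neh; suff [k nek] : exists k, flip (h k) i != flip (h k) j.
    by rewrite (bigD1 k)//= /H (negbTE nek) mul0r.
  apply/existsP; apply: contraNT neh; rewrite negb_exists => /forallP eqf.
  by apply/eqP/ffunP => k; rewrite !ffunE; apply/eqP; rewrite -[_ == _]negbK.
have avgH : avg H = 2^-1.
  have E s : H s = 2^-1 * (1 + sgn s i * sgn s j).
    by rewrite /H /sgn; case: flip; case: flip; rewrite /= ?expr1 ?expr0; lra.
  rewrite (eq_avg E) avgZ avgD avg_cst ?card_seed_gt0// avg_sgn2//.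
  by rewrite (negbTE ij) addr0 mulr1.
rewrite (eq_avg HE) (avg_ffun_prod (fun=> H)) prodr_const card_ord avgH.
by rewrite exprVn.
Qed.

End Hashing.

(** * The recursive estimator *)

Definition level_seed (w b : nat) : finType :=
  (seed w * {ffun 'I_b -> seed w})%type.

Lemma card_hash_seed_gt0 w b : (0 < #|{ffun 'I_b -> seed w}|)%N.
Proof. by rewrite card_ffun expn_gt0 card_seed_gt0. Qed.

Lemma card_level_seed w b : #|level_seed w b| = (2 ^ (w.+1 * b.+1))%N.
Proof.
by rewrite card_prod card_ffun card_ord !card_seed -expnM -expnD mulnS.
Qed.

Lemma card_level_seed_gt0 w b : (0 < #|level_seed w b|)%N.
Proof. by rewrite card_level_seed expn_gt0. Qed.

Section Estimate.

Variables (R : realType) (n w b : nat).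
Implicit Types (D : {set 'I_n}) (h : {ffun 'I_b -> seed w}).
Implicit Types (sd : level_seed w b) (sds : seq (level_seed w b)).

(* [xhat l h D j] is the value of f_j that is recovered at level [l]. *)
Fixpoint estimate
    (xhat : nat -> {ffun 'I_b -> seed w} -> {set 'I_n} -> 'I_n -> R)
    (base : {set 'I_n} -> R) (l : nat) (D : {set 'I_n})
    (sds : seq (level_seed w b)) : R :=
  if sds is sd :: sds' then
    2 * estimate xhat base l.+1 (subsample D sd.1) sds' -
    \sum_(j in D) sgn R sd.1 j * xhat l sd.2 D j
  else base D.

Definition subsamples D sds : {set 'I_n} :=
  foldl (fun D' sd => subsample D' sd.1) D sds.

(** The recursion reads recovered values only at elements that survive up to their level. This
    allows exchanging idealized values for actual ones; [sd0] is only a default for [nth]. *)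
Lemma eq_estimate xhat xhat' base base' l D sds sd0 :
  (forall i j, (i < size sds)%N -> j \in subsamples D (take i sds) ->
     xhat (l + i)%N (nth sd0 sds i).2 (subsamples D (take i sds)) j =
     xhat' (l + i)%N (nth sd0 sds i).2 (subsamples D (take i sds)) j) ->
  base (subsamples D sds) = base' (subsamples D sds) ->
  estimate xhat base l D sds = estimate xhat' base' l D sds.
Proof.
elim: sds l D => [|sd sds IH] l D eqx eqb //=.
congr (_ * _ - _); last first.
  apply: eq_bigr => j jD; congr (_ * _).
  by have := eqx 0%N j isT; rewrite addn0; apply.
apply: IH => // i j ilt jD.
by have := eqx i.+1 j ilt; rewrite addnS; apply.
Qed.

(** For [f = 1] this gives the expected number of elements left after [m] levels. *)
Lemma avg_sum_subsamples m D (f : 'I_n -> R) :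
  2 ^+ m * avg (fun sds : m.-tuple (level_seed w b) =>
    \sum_(j in subsamples D sds) f j) = \sum_(j in D) f j.
Proof.
elim: m D => [|m IH] D; first by rewrite avg_tuple0 mul1r.
rewrite avg_tupleS exprS -mulrA -[2 ^+ m * _]avgZ.
under eq_avg do rewrite /= -/(subsamples _ _) IH.
rewrite avg_pair/=; under eq_avg do rewrite avg_cst ?card_hash_seed_gt0//.
exact: avg_sum_subsample.
Qed.

Definition colliding D h (j : 'I_n) : {set 'I_n} :=
  [set i in D | (i != j) && (hash h i == hash h j)].

Lemma avg_sum_colliding D (f : 'I_n -> R) : (n <= 2 ^ w)%N ->
  (forall j, 0 <= f j) ->
  avg (fun h => \sum_(j in D) f j * \sum_(i in colliding D h j) f i) <=
  (2 ^+ b)^-1 * (\sum_(j in D) f j) ^+ 2.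
Proof.
move=> nw f0; rewrite expr2 big_distrlr/= mulr_sumr avg_sum.
apply: ler_sum => j jD; rewrite avgZ -mulr_sumr [leRHS]mulrCA ler_wpM2l//.
have E h : \sum_(i in colliding D h j) f i =
    \sum_(i in D | i != j) f i * (hash h i == hash h j)%:R.
  rewrite big_mkcond [RHS]big_mkcond; apply: eq_bigr => i _.
  by rewrite inE; case: (i \in D) => //=; case: eqVneq => //= _;
    case: eqVneq; rewrite ?mulr1 ?mulr0.
(* The diagonal term [i = j] occurs only on the right, where it is nonnegative. *)
rewrite (eq_avg E) avg_sum mulr_sumr [leRHS](bigD1 j)//= ler_wpDl//.
  by rewrite mulr_ge0 ?invr_ge0 ?exprn_ge0.
rewrite le_eqVlt; apply/orP; left; apply/eqP.
by apply: eq_bigr => i /andP[_ ij]; rewrite avgZ hash_collision// mulrC.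
Qed.

(** The first moment is controlled by the second: averaging over the signs removes the cross terms,
    and averaging over the hashing bounds the collisions. *)
Lemma avg_residual D (f : 'I_n -> R) (r : {ffun 'I_b -> seed w} -> 'I_n -> R)
    (e beta : R) : (n <= 2 ^ w)%N -> (forall j, 0 <= f j) -> 0 < beta ->
  e ^+ 2 + (2 ^+ b)^-1 <= beta ^+ 2 ->
  (forall h j, j \in D ->
     r h j ^+ 2 <= e ^+ 2 * f j ^+ 2 + f j * \sum_(i in colliding D h j) f i) ->
  avg (fun sd => `|\sum_(j in D) sgn R sd.1 j * r sd.2 j|) <=
  beta * \sum_(j in D) f j.
Proof.
move=> nw f0 beta0 ebeta rle; set S := \sum_(j in D) f j.
have S0 : 0 <= S by apply: sumr_ge0.
(* The main case divides by [beta * S]; for [S = 0] all residuals vanish. *)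
have [S_eq0|S_neq0] := eqVneq S 0.
  have r0 h j : j \in D -> r h j = 0.
    move=> jD; have fj0 : f j = 0.
      apply/eqP; rewrite eq_le f0 andbT -S_eq0 /S (bigD1 j)//= lerDl.
      exact: sumr_ge0.
    apply/eqP; rewrite -sqrf_eq0 eq_le sqr_ge0 andbT.
    by apply: le_trans (rle h j jD) _; rewrite fj0 mul0r expr0n/= mulr0 addr0.
  rewrite (eq_avg (G := fun=> 0)); first by
    rewrite avg_cst ?S_eq0 ?mulr0 ?card_level_seed_gt0.
  by move=> sd; rewrite big1 ?normr0// => j jD; rewrite r0 ?mulr0.
have {S0 S_neq0} S_gt0 : 0 < S by rewrite lt_def S_neq0.
set t := beta * S; have t_gt0 : 0 < t by rewrite mulr_gt0.
have avg_sqr : avg (fun sd => (\sum_(j in D) sgn R sd.1 j * r sd.2 j) ^+ 2)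
    <= t ^+ 2.
  (* The residuals depend on the hash seeds only, so the signs are averaged with [h] fixed. *)
  rewrite avg_pair avg_swap /=.
  under eq_avg do rewrite avg_sgn_sum_sqr//.
  apply: (@le_trans _ _ (avg (fun h => e ^+ 2 * S ^+ 2 +
      \sum_(j in D) f j * \sum_(i in colliding D h j) f i))).
    apply: ler_avg => h; apply: le_trans (ler_sum _ (rle h)) _.
    rewrite big_split/= lerD2r -mulr_sumr ler_wpM2l ?sqr_ge0//.
    rewrite expr2 big_distrlr/=; apply: ler_sum => j jD.
    rewrite (bigD1 j)//= expr2 lerDl; apply: sumr_ge0 => i _.
    exact: mulr_ge0.
  rewrite avgD avg_cst ?card_hash_seed_gt0// /t exprMn.
  apply: le_trans (lerD (lexx _) (avg_sum_colliding D nw f0)) _.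
  by rewrite -mulrDl ler_wpM2r// sqr_ge0.
(* AM-GM: 2 |X| <= t + X^2 / t *)
apply: (@le_trans _ _ (avg (fun sd =>
    2^-1 * t + 2^-1 / t * (\sum_(j in D) sgn R sd.1 j * r sd.2 j) ^+ 2))).
  apply: ler_avg => sd; set X := \sum_(j in D) _.
  rewrite -[X ^+ 2]real_normK ?num_real// -(ler_pM2l t_gt0) mulrDr.
  have -> : t * (2^-1 / t * `|X| ^+ 2) = 2^-1 * `|X| ^+ 2.
    by rewrite mulrA [t * _]mulrC divfK // gt_eqF.
  have := sqr_ge0 (t - `|X|); nra.
rewrite avgD avg_cst ?card_level_seed_gt0// avgZ.
have : 2^-1 / t * avg (fun sd => (\sum_(j in D) sgn R sd.1 j * r sd.2 j) ^+ 2)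
    <= 2^-1 * t.
  rewrite -mulrA ler_wpM2l ?invr_ge0// ler_pdivrMl// -expr2; exact: avg_sqr.
by lra.
Qed.

Lemma avg_estimate (f : 'I_n -> R)
    (xhat : nat -> {ffun 'I_b -> seed w} -> {set 'I_n} -> 'I_n -> R)
    (e beta : R) m l D :
  (n <= 2 ^ w)%N -> (forall j, 0 <= f j) -> 0 < beta ->
  e ^+ 2 + (2 ^+ b)^-1 <= beta ^+ 2 ->
  (forall l' D' h j, j \in D' -> (f j - xhat l' h D' j) ^+ 2 <=
     e ^+ 2 * f j ^+ 2 + f j * \sum_(i in colliding D' h j) f i) ->
  avg (fun sds : m.-tuple (level_seed w b) =>
    `|estimate xhat (fun D' => \sum_(j in D') f j) l D sds - \sum_(j in D) f j|)
  <= m%:R * beta * \sum_(j in D) f j.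
Proof.
move=> nw f0 beta0 ebeta xhat_ok; elim: m l D => [|m IH] l D.
  by rewrite avg_tuple0/= subrr normr0 mul0r mul0r.
set S := \sum_(j in D) f j; pose T sd := \sum_(j in subsample D sd.1) f j.
pose X sd := \sum_(j in D) sgn R sd.1 j * (f j - xhat l sd.2 D j).
pose Z sd (t : seq (level_seed w b)) :=
  estimate xhat (fun D' => \sum_(j in D') f j) l.+1 (subsample D sd.1) t.
have card0 : (0 < #|{: m.-tuple (level_seed w b)}|)%N.
  by rewrite card_tuple expn_gt0 card_level_seed_gt0.
rewrite avg_tupleS; apply: (@le_trans _ _ (avg (fun sd =>
    2 * (m%:R * beta * T sd) + `|X sd|))).
  apply: ler_avg => sd.
  apply: (@le_trans _ _ (avg (fun t : m.-tuple (level_seed w b) =>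
      2 * `|Z sd t - T sd| + `|X sd|))).
    apply: ler_avg => t /=; rewrite -/(Z sd t).
    have -> : 2 * Z sd t - \sum_(j in D) sgn R sd.1 j * xhat l sd.2 D j - S =
        2 * (Z sd t - T sd) + X sd.
      rewrite mulrBr /T sum_subsample big_split/= -/S /X.
      under [X in _ = _ + X]eq_bigr do rewrite mulrBr.
      rewrite sumrB; lra.
    by apply: le_trans (ler_normD _ _) _; rewrite normrM ger0_norm.
  by rewrite avgD avg_cst// avgZ lerD2r ler_wpM2l//; exact: IH.
rewrite avgD avgZ [avg (fun sd => _ * T sd)]avgZ mulrCA.
(* Halving the sum on average compensates the factor 2 of the recursion, so each level adds only
   [beta * S]. *)
have -> : 2 * avg T = S.
  rewrite avg_pair /T /=; under eq_avg do rewrite avg_cst ?card_hash_seed_gt0//.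
  exact: avg_sum_subsample.
have : avg (fun sd => `|X sd|) <= beta * S.
  apply: (avg_residual (e := e) (r := fun h j => f j - xhat l h D j)) => // h j.
  exact: xhat_ok.
rewrite -natr1 mulrDl mul1r mulrDl; lra.
Qed.

End Estimate.

(** * Parallel copies on random substreams *)

Section Run.

Variables (R : realType) (E S : Type) (C : finType) (upd : C -> S -> E -> S).
Variable F : S -> R.

(** Expectation with the coins drawn one event at a time. A stream and its filtered version need
    coin tuples of different lengths; in this form they can be compared by induction on the
    events. *)
Fixpoint avg_run (es : seq E) (s : S) : R :=
  if es is e :: es' then avg (fun c => avg_run es' (upd c s e)) else F s.

Lemma avg_foldl es s :
  avg (fun t : (size es).-tuple C =>
    F (foldl (fun s' ce => upd ce.1 s' ce.2) s (zip t es))) = avg_run es s.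
Proof.
elim: es s => [|e es IH] s; first by rewrite avg_tuple0.
by rewrite avg_tupleS; apply: eq_avg => c; exact: IH.
Qed.

End Run.

(** Coins drawn at skipped events average out, and at the other events [f] carries the uniform law
    on [C'] to that on [C]. *)
Lemma avg_run_filter (R : realType) (E S : Type) (C C' : finType)
    (upd : C -> S -> E -> S) (F : S -> R) (p : pred E) (f : C' -> C) es s :
  (0 < #|C'|)%N -> (forall H : C -> R, avg (fun c => H (f c)) = avg H) ->
  avg_run (fun c s' e => if p e then upd (f c) s' e else s') F es s =
  avg_run upd F (filter p es) s.
Proof.
move=> C'0 avgf; elim: es s => //= e es IH s; case: (p e) => /=.
  by rewrite -avgf; apply: eq_avg => c; rewrite IH.
by rewrite avg_cst.
Qed.

(** Ends of time steps always pass, so that elements expire in a substream at the same time as in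
    the full stream. *)
Definition passes (n : nat) (P : {set 'I_n}) (e : option 'I_n) : bool :=
  if e is Some j then j \in P else true.

Definition substream (n : nat) (P : {set 'I_n}) (D : stream n) : stream n :=
  [seq filter (mem P) b | b <- D].

Lemma events_substream n (P : {set 'I_n}) (D : stream n) :
  events (substream P D) = filter (passes P) (events D).
Proof.
rewrite /events /substream filter_flatten -!map_comp; congr flatten.
apply: eq_map => b /=; rewrite filter_rcons/= filter_map; congr rcons.
Qed.

Lemma window_substream tau n (P : {set 'I_n}) (D : stream n) :
  window tau (substream P D) = filter (mem P) (window tau D).
Proof. by rewrite /window /substream size_map -map_drop filter_flatten. Qed.

Lemma bounded_substream tau n N (P : {set 'I_n}) (D : stream n) :
  bounded_window tau N D -> bounded_window tau N (substream P D).
Proof.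
move=> Dle t; apply: leq_trans (Dle t); rewrite /substream -map_take.
by rewrite -/(substream P _) window_substream size_filter count_size.
Qed.

Lemma freq_substream (R : realType) tau n (P : {set 'I_n}) (D : stream n) j :
  freq (window tau (substream P D)) 0 j =
  if j \in P then freq (window tau D) 0 j else 0 :> R.
Proof.
rewrite window_substream !mxE; case: ifPn => jP.
  rewrite count_filter; congr _%:R; apply: eq_count => i /=.
  by case: eqVneq => //= ->.
by rewrite (count_memPn _) // mem_filter /= (negbTE jP).
Qed.

Lemma card_tape_gt0 n Q A (M : algorithm n Q A) (D : stream n) :
  (0 < #|tape M D|)%N.
Proof. by rewrite !card_prod card_tuple !muln_gt0 expn_gt0 coin_gt0. Qed.

(** * Copies of one algorithm behind randomly chosen filters *)

Section Parallel.

Variables (n : nat) (Q A A' : Type) (M : algorithm n Q A) (I Sigma : finType).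
Hypothesis Sigma_gt0 : (0 < #|Sigma|)%N.
Variable cell : Sigma -> I -> {set 'I_n}.
Variable comb : Q -> Sigma -> (I -> A) -> A'.

Definition par_coin : finType := (Sigma * {ffun I -> coin M})%type.

Lemma par_coin_gt0 : (0 < #|par_coin|)%N.
Proof.
by rewrite card_prod muln_gt0 Sigma_gt0 card_ffun expn_gt0 coin_gt0.
Qed.

(** The seeds in [Sigma] are drawn at initialization and kept in the state, since both the filters
    and the final combination depend on them and only the state persists. *)
Definition parallel : algorithm n Q A' :=
  @Algorithm n Q A' (Sigma * {ffun I -> state M})%type par_coin par_coin_gt0
    (fun c => (c.1, [ffun i => init (c.2 i)]))
    (fun c s e => (s.1, [ffun i => if passes (cell s.1 i) e
                                   then update (c.2 i) (s.2 i) e else s.2 i]))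
    (fun c s q => comb q s.1 (fun i => answer (c.2 i) (s.2 i) q)).

Definition cell_update (i : I) (P : {set 'I_n}) (c : par_coin) (s : state M)
    (e : option 'I_n) : state M :=
  if passes P e then update (c.2 i) s e else s.

(** The tape without the initial seeds. Fixing the seeds and averaging over the rest makes every
    filter a fixed set. *)
Definition par_rest (D : stream n) : finType :=
  ({ffun I -> coin M} * (size (events D)).-tuple par_coin * par_coin)%type.

Lemma card_par_rest_gt0 D : (0 < #|par_rest D|)%N.
Proof.
have -> : #|par_rest D| =
    (#|{ffun I -> coin M}| * #|par_coin| ^ size (events D) * #|par_coin|)%N.
  by rewrite -card_tuple -!card_prod.
by rewrite !muln_gt0 expn_gt0 par_coin_gt0 card_ffun expn_gt0 coin_gt0.
Qed.

(* A copy depends on the seeds only through its filter [P]. *)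
Definition cell_output (D : stream n) (i : I) (P : {set 'I_n}) (w : par_rest D)
    (q : Q) : A :=
  answer (w.2.2 i) (foldl (fun s ce => cell_update i P ce.1 s ce.2)
    (init (w.1.1 i)) (zip w.1.2 (events D))) q.

Definition rest_of (D : stream n) (w : tape parallel D) : par_rest D :=
  (w.1.1.2, w.1.2, w.2).

Lemma parallel_output (D : stream n) (w : tape parallel D) q :
  output w q =
  comb q w.1.1.1 (fun i => cell_output i (cell w.1.1.1 i) (rest_of w) q).
Proof.
case: w => [[[sigma c] t] d]; rewrite /output /final_state /=.
set u := foldl _ _ _.
have -> : u = (sigma, [ffun i => foldl
    (fun s ce => cell_update i (cell sigma i) ce.1 s ce.2)
    (init (c i)) (zip t (events D))]).
  rewrite /u.
  (* The initial states are gathered into one function [s], which is then generalized for the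
     induction over the events. *)
  rewrite (_ : [ffun i => foldl _ (init _) _] = [ffun i => foldl
    (fun s ce => cell_update i (cell sigma i) ce.1 s ce.2)
    ([ffun i => init (c i)] i) (zip t (events D))]); last first.
    by apply/ffunP => i; rewrite !ffunE.
  move: [ffun i => init (c i)] => s.
  elim: (zip t (events D)) s => [|ce ces IH] s /=.
    by congr (_, _); apply/ffunP => i; rewrite ffunE.
  rewrite IH; congr (_, _); apply/ffunP => i.
  by rewrite !ffunE.
by congr comb; apply: boolp.funext => i; rewrite /= ffunE.
Qed.

Lemma avg_tape (R : realType) (D : stream n) (F : Sigma -> par_rest D -> R) :
  avg (fun w : tape parallel D => F w.1.1.1 (rest_of w)) =
  avg (fun sigma => avg (F sigma)).
Proof.
rewrite 3!avg_pair; apply: eq_avg => sigma.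
by rewrite 2!avg_pair.
Qed.

(** For a fixed filter, copy [i] behaves in law like [M] on the substream, because its coins are
    marginals of the joint coins and skipped events leave its state alone. *)
Lemma avg_cell_output (R : realType) (D : stream n) i P (F : A -> R) q :
  avg (fun w : par_rest D => F (cell_output i P w q)) =
  avg (fun w : tape M (substream P D) => F (output w q)).
Proof.
have avg_coin (H : coin M -> R) : avg (fun c : par_coin => H (c.2 i)) = avg H.
  by rewrite avg_pair/= avg_cst// avg_ffun1// coin_gt0.
have avg_init (H : coin M -> R) :
    avg (fun c : {ffun I -> coin M} => H (c i)) = avg H.
  by rewrite avg_ffun1// coin_gt0.
rewrite 2!avg_pair [RHS]avg_pair [RHS]avg_pair.
rewrite -avg_init; apply: eq_avg => c /=.
(* The query coin is fixed first, so that the inner average runs over the update coins alone. *)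
rewrite [LHS]avg_swap [RHS]avg_swap -avg_coin; apply: eq_avg => d /=.
rewrite /cell_output /output /final_state /=.
rewrite (avg_foldl (cell_update i P) (fun s => F (answer (d.2 i) s q))).
rewrite (avg_foldl (@update _ _ _ M) (fun s => F (answer (d.2 i) s q))).
rewrite events_substream.
rewrite -(@avg_run_filter _ _ _ _ par_coin _ _ _ (fun c => c.2 i))//.
exact: par_coin_gt0.
Qed.

End Parallel.

(** * Correctness of the sketch *)

Definition lookup (R : realType) n (T : seq (R * 'I_n)) (j : 'I_n) : R :=
  head 0 [seq p.1 | p <- T & p.2 == j].

(** A listed value has relative error [e]. An unlisted [j] is looked up as 0 and is not heavy, so
    its value is at most the sum of the others. *)
Lemma lookup_residual (R : realType) n (e : R) (G : R -> R) (V : 'rV[R]_n) T j :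
  0 <= e -> (forall i, 0 <= G (V 0 i)) -> core_ok e 1 G V T ->
  (G (V 0 j) - lookup T j) ^+ 2 <=
  e ^+ 2 * G (V 0 j) ^+ 2 + G (V 0 j) * \sum_(i | i != j) G (V 0 i).
Proof.
move=> e0 G0 /andP[/allP T_ok /forallP/(_ j) T_heavy].
have S0 : 0 <= \sum_(i | i != j) G (V 0 i) by exact: sumr_ge0.
have [jT|jT] := boolP (j \in unzip2 T); last first.
  move: T_heavy; rewrite (negbTE jT) implybF /heavy mul1r -leNgt => G_le.
  have -> : lookup T j = 0.
    rewrite /lookup (_ : filter _ T = [::])//.
    apply/eqP; rewrite -[_ == _]negbK -has_filter; apply: contra jT.
    by move=> /hasP[p pT /eqP <-]; exact: map_f.
  rewrite subr0 ler_wpDl ?mulr_ge0 ?sqr_ge0// expr2.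
  exact: ler_wpM2l.
have [p pT xE] : exists2 p, p \in [seq p <- T | p.2 == j] & lookup T j = p.1.
  rewrite /lookup; case E : [seq p <- T | p.2 == j] => [|p s].
    move/mapP: jT => [p pT jE].
    suff : p \in [::] by []; by rewrite -E mem_filter pT -jE eqxx.
  by exists p; rewrite ?mem_head.
move: pT; rewrite mem_filter => /andP[/eqP pj /T_ok]; rewrite pj -xE.
rewrite /approx; have := G0 j.
set y := G _; set x := lookup _ _ => y0 /andP[? ?].
rewrite ler_wpDr ?mulr_ge0// -exprMn.
by rewrite -[leLHS]real_normK ?num_real// lerXn2r ?nnegrE ?mulr_ge0//
  ler_norml; apply/andP; split; lra.
Qed.

Section Sketch.

Variables (R : realType) (n w b p : nat).
Variable M : algorithm n (R -> R) (seq (R * 'I_n)).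

Definition bucket (D : {set 'I_n}) (h : {ffun 'I_b -> seed w})
  (bkt : {ffun 'I_b -> bool}) : {set 'I_n} := [set j in D | hash h j == bkt].

Definition sketch_cell (sds : p.+1.-tuple (level_seed w b))
    (i : 'I_p.+1 * {ffun 'I_b -> bool}) : {set 'I_n} :=
  bucket (subsamples [set: 'I_n] (take i.1 sds)) (tnth sds i.1).2 i.2.

(** Levels are natural numbers in [estimate]; [inord] is exact on those that occur, namely
    [l <= p]. *)
Definition sketch_sum (G : R -> R) (sds : p.+1.-tuple (level_seed w b))
    (out : 'I_p.+1 * {ffun 'I_b -> bool} -> seq (R * 'I_n)) : R :=
  estimate (fun l h _ j => lookup (out (inord l, hash h j)) j) (fun=> 0)
    0 [set: 'I_n] sds.

Lemma card_sketch_seed_gt0 : (0 < #|{: p.+1.-tuple (level_seed w b)}|)%N.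
Proof. by rewrite card_tuple expn_gt0 card_level_seed_gt0. Qed.

Definition sketch : algorithm n (R -> R) R :=
  parallel M card_sketch_seed_gt0 sketch_cell sketch_sum.

(** The failure probability 3/10 is a sum of three bounds 1/10: some copy fails, some element
    survives all levels, or the error of the idealized estimate exceeds [eps * S]. *)
Lemma sketch_correct tau N (eps e beta delta : R) (calG : set (R -> R)) :
  (forall G, calG G -> {homo G : x y / x <= y} /\ G 0 = 0) ->
  universal_core_algorithm tau N e delta 1 calG M ->
  (n <= 2 ^ w)%N -> (10 * n <= 2 ^ p.+1)%N -> 0 <= eps -> 0 <= e -> 0 < beta ->
  e ^+ 2 + (2 ^+ b)^-1 <= beta ^+ 2 -> p.+1%:R * beta <= eps / 10 ->
  (p.+1 * 2 ^ b)%:R * delta <= 1 / 10 ->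
  universal_sum_algorithm tau N eps (3 / 10) calG sketch.
Proof.
move=> calG_ok M_ok nw np eps0 e0 beta0 ebeta pbeta pdelta D D_le G G_in.
have [G_homo G_eq0] := calG_ok G G_in.
pose V P : 'rV[R]_n := freq (window tau (substream P D)).
pose f j := G (freq (window tau D) 0 j).
have G_freq (W : seq 'I_n) j : 0 <= G (freq W 0 j).
  by rewrite -G_eq0; apply: G_homo; rewrite mxE ler0n.
have f0 j : 0 <= f j by exact: G_freq.
set S := \sum_j f j; have S0 : 0 <= S by exact: sumr_ge0.
pose ok P T := core_ok e 1 G (V P) T.
pose rest := par_rest M ('I_p.+1 * {ffun 'I_b -> bool})%type
  {: p.+1.-tuple (level_seed w b)} D.
(* Replacing the failed lists by exact values makes the recovered values good
   for every [r], so that the average over the seeds is taken at fixed [r]. *)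
pose xhat (r : rest) l h D' j :=
  let P := bucket D' h (hash h j) in
  let T := cell_output (inord l, hash h j) P r G in
  if ok P T then lookup T j else f j.
pose Z r (sds : p.+1.-tuple (level_seed w b)) :=
  estimate (xhat r) (fun D' => \sum_(j in D') f j) 0 [set: 'I_n] sds.
pose bad i P (r : rest) : bool := ~~ ok P (cell_output i P r G).
have xhat_ok r l (D' : {set 'I_n}) h j : j \in D' ->
    (f j - xhat r l h D' j) ^+ 2 <=
    e ^+ 2 * f j ^+ 2 + f j * \sum_(i in colliding D' h j) f i.
  move=> jD'; rewrite /xhat.
  set P := bucket _ _ _; set T := cell_output _ _ _ _.
  case: ifP => [T_ok|_]; last first.
    by rewrite subrr expr0n addr_ge0 ?mulr_ge0 ?sqr_ge0 ?sumr_ge0.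
  (* Elements outside the bucket have frequency 0 and [G 0 = 0], so the competitors of [j] in its
     bucket are exactly the colliding elements. *)
  have fP i : G (V P 0 i) = if i \in P then f i else 0.
    by rewrite freq_substream; case: ifP; rewrite ?G_eq0.
  have := lookup_residual j e0 (fun i => G_freq _ i) T_ok.
  rewrite fP inE jD' eqxx; congr (_ <= _ + _ * _).
  rewrite big_mkcond [RHS]big_mkcond; apply: eq_bigr => i _.
  rewrite fP !inE; case: (i \in D'); case: (i != j) => //=.
(* Union bound before averaging: the first two terms count failed copies and survivors, and each is
   at least 1 when nonzero. *)
have pointwise sds r :
    (~~ sum_ok eps G (freq (window tau D))
      (sketch_sum G sds (fun i => cell_output i (sketch_cell sds i) r G)))%:R <=
    \sum_i (bad i (sketch_cell sds i) r)%:R +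
    \sum_(j in subsamples [set: 'I_n] sds) 1 +
    (eps * S < `|Z r sds - S|)%R%:R :> R.
  have S1_ge0 : 0 <= \sum_i (bad i (sketch_cell sds i) r)%:R :> R.
    by apply: sumr_ge0 => i _; exact: ler0n.
  have S2_ge0 : 0 <= \sum_(j in subsamples [set: 'I_n] sds) 1 :> R.
    exact: sumr_ge0.
  have S3_ge0 : 0 <= (eps * S < `|Z r sds - S|)%R%:R :> R by exact: ler0n.
  have fail_le1 (c : bool) : c%:R <= 1 :> R by case: c; rewrite ?ler01.
  have [/existsP[i bad_i]|no_bad] :=
    boolP [exists i, bad i (sketch_cell sds i) r].
    apply: le_trans (fail_le1 _) _; rewrite -addrA ler_wpDr ?addr_ge0//.
    by rewrite (bigD1 i)//= bad_i lerDl sumr_ge0.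
  have [D_eq0|/finset.set0Pn[j jD]] :=
    eqVneq (subsamples [set: 'I_n] sds) finset.set0; last first.
    apply: le_trans (fail_le1 _) _; rewrite ler_wpDr// ler_wpDl//.
    by rewrite (bigD1 j)//= lerDl sumr_ge0.
  rewrite ler_wpDl ?addr_ge0//; set out := fun i => _.
  (* With no failed copy the recovered values agree, and with no survivor both base values are 0. *)
  have -> : sketch_sum G sds out = Z r sds.
    rewrite /Z /sketch_sum.
    have sd0 : level_seed w b := tnth sds ord0.
    apply: (eq_estimate (sd0 := sd0)) => [i j|]; last by rewrite D_eq0 big_set0.
    rewrite size_tuple add0n => ip jD; rewrite /xhat /out /sketch_cell /=.
    have ii : (inord i : 'I_p.+1) = i :> nat by rewrite inordK.
    rewrite (tnth_nth sd0) ii; case: ifP => // /negbT nok.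
    case/existsP: no_bad; exists (inord i, hash (nth sd0 sds i).2 j).
    by rewrite /bad /sketch_cell /= (tnth_nth sd0) ii.
  have -> : sum_ok eps G (freq (window tau D)) (Z r sds) =
      (`|Z r sds - S| <= eps * S).
    rewrite /sum_ok /approx -/S ler_distl.
    by rewrite !mulrDl !mul1r mulNr.
  by rewrite ltNge.
rewrite Pr_predC ?card_tape_gt0// lerD2l lerN2.
under eq_avg do rewrite parallel_output.
rewrite (avg_tape _ _ _ (fun sds r => (~~ sum_ok eps G (freq (window tau D))
      (sketch_sum G sds (fun i => cell_output i (sketch_cell sds i) r G)))%:R)).
have rest0 : (0 < #|rest|)%N.
  by apply: card_par_rest_gt0; exact: card_sketch_seed_gt0.
apply: le_trans.
  by apply: ler_avg => sds; apply: ler_avg => r; exact: pointwise.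
under eq_avg do rewrite avgD avgD avg_sum (avg_cst _ rest0).
rewrite avgD avgD (avg_swap (fun sds r => (eps * S < `|Z r sds - S|)%R%:R)).
have T1 : avg (fun sds =>
      \sum_i avg (fun r => (bad i (sketch_cell sds i) r)%:R))
    <= 1 / 10 :> R.
  apply: le_trans pdelta; rewrite -[leRHS](avg_cst _ card_sketch_seed_gt0).
  apply: ler_avg => sds.
  have -> : (p.+1 * 2 ^ b)%:R * delta =
      \sum_(i : 'I_p.+1 * {ffun 'I_b -> bool}) delta.
    rewrite sumr_const card_prod card_ord card_ffun card_bool card_ord.
    by rewrite mulr_natl.
  apply: ler_sum => i _; set P := sketch_cell sds i.
  (* At fixed seeds the cell is a fixed set, so the guarantee of [M] applies to its substream. *)
  rewrite (avg_cell_output _ card_sketch_seed_gt0 _ i P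
    (fun T => (~~ ok P T)%:R)).
  have := M_ok _ (bounded_substream P D_le) G G_in.
  by rewrite Pr_predC ?card_tape_gt0// lerD2l lerN2.
have T2 : avg (fun sds : p.+1.-tuple (level_seed w b) =>
    \sum_(j in subsamples [set: 'I_n] sds) 1) <= 1 / 10 :> R.
  have := avg_sum_subsamples w b p.+1 [set: 'I_n] (fun _ : 'I_n => 1 : R).
  rewrite [RHS]sumr_const cardsT card_ord => avgE.
  have : (10 * n)%:R <= 2 ^+ p.+1 :> R by rewrite -natrX ler_nat.
  rewrite natrM -avgE; have : 0 < 2 ^+ p.+1 :> R by rewrite exprn_gt0.
  set x := avg _; set y := 2 ^+ _; nra.
have T3 : avg (fun r => avg (fun sds => (eps * S < `|Z r sds - S|)%R%:R))
    <= 1 / 10 :> R.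
  rewrite -[leRHS](avg_cst _ rest0); apply: ler_avg => r.
  apply: avg_markov; first exact: card_sketch_seed_gt0.
  - exact: mulr_ge0.
  - lra.
  have := avg_estimate p.+1 0 [set: 'I_n] nw f0 beta0 ebeta (xhat_ok r).
  have -> : \sum_(j in [set: 'I_n]) f j = S.
    by apply: eq_bigl => j; rewrite inE.
  move=> /le_trans; apply; rewrite mulrA ler_wpM2r//; lra.
lra.
Qed.

End Sketch.

(** * Memory and asymptotics *)

Lemma up_log_mul_leq x y i j :
  (up_log 2 x <= i)%N -> (up_log 2 y <= j)%N -> (up_log 2 (x * y) <= i + j)%N.
Proof.
move=> xi yj; apply: up_log_min => //; rewrite expnD.
by apply: leq_mul; (apply: leq_trans; first exact: (up_logP (p := 2)));
  rewrite // leq_exp2l.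
Qed.

Lemma up_log_expn_leq x m : (up_log 2 (x ^ m) <= up_log 2 x * m)%N.
Proof.
apply: up_log_min => //; case: m => [|m]; first by rewrite muln0.
by rewrite expnM leq_exp2r // up_logP.
Qed.

(** The first summand pays for the stored seeds, the second for one copy of [M] per level and
    bucket. *)
Lemma memory_sketch (R : realType) n w b p
    (M : algorithm n (R -> R) (seq (R * 'I_n))) :
  (memory_bits (sketch w b p M) <=
   w.+1 * b.+1 * p.+1 + memory_bits M * (p.+1 * 2 ^ b))%N.
Proof.
rewrite /memory_bits /= card_prod card_tuple card_level_seed card_ffun.
rewrite card_prod card_ffun card_bool !card_ord -expnM.
by apply: up_log_mul_leq; [exact: up_log_min|exact: up_log_expn_leq].
Qed.

(** * Polylogarithmic bounds and their reciprocals *)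

Section Asymptotics.

Variable R : realType.
Implicit Types f g : nat -> nat -> nat.
Local Notation L n N := (log2 (n * N)%:R : R).

Lemma ln2_gt0 : 0 < ln 2 :> R.
Proof. by rewrite ln_gt0 // ltr1n. Qed.

Lemma log2_exp2 (x m : nat) : (2 ^ m <= x)%N -> m%:R <= log2 x%:R :> R.
Proof.
move=> mx; rewrite /log2 ler_pdivlMr ?ln2_gt0// mulr_natl -lnXn//.
by rewrite ler_ln ?posrE ?exprn_gt0// -?natrX ?ler_nat// ltr0n;
  apply: leq_trans mx; rewrite expn_gt0.
Qed.

Lemma log2_ge0 n N : (0 < n)%N -> (0 < N)%N -> 0 <= L n N.
Proof. by move=> n0 N0; apply: (@log2_exp2 _ 0); rewrite muln_gt0 n0. Qed.

Lemma polylog_le f g :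
  (forall n N, (0 < n)%N -> (0 < N)%N -> (f n N <= g n N)%N) ->
  @polylog R g -> @polylog R f.
Proof.
move=> fg [c [d gle]]; exists c, d => n N n0 N0.
by apply: le_trans (gle n N n0 N0); rewrite ler_nat fg.
Qed.

Lemma polylog_cst c : @polylog R (fun _ _ => c).
Proof. by exists c%:R, 0%N => n N _ _; rewrite mulr1. Qed.

Lemma polylogM f g : @polylog R f -> @polylog R g ->
  @polylog R (fun n N => (f n N * g n N)%N).
Proof.
move=> [c [d fle]] [c' [d' gle]]; exists (c * c'), (d + d')%N => n N n0 N0.
by rewrite natrM exprD mulrACA ler_pM// ?fle ?gle.
Qed.

Lemma polylogD f g : @polylog R f -> @polylog R g ->
  @polylog R (fun n N => (f n N + g n N)%N).
Proof.
move=> [c [d fle]] [c' [d' gle]].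
exists (`|c| + `|c'|), (d + d')%N => n N n0 N0; rewrite natrD mulrDl.
have L1 : 1 <= 1 + L n N by rewrite lerDl log2_ge0.
apply: lerD.
  apply: le_trans (fle n N n0 N0) _.
  apply: le_trans (ler_wpM2r _ (ler_norm c)) _; first by rewrite exprn_ge0; lra.
  by rewrite ler_wpM2l// ler_weXn2l ?leq_addr.
apply: le_trans (gle n N n0 N0) _.
apply: le_trans (ler_wpM2r _ (ler_norm c')) _; first by rewrite exprn_ge0; lra.
by rewrite ler_wpM2l// ler_weXn2l ?leq_addl.
Qed.

Lemma polylog_up_log : @polylog R (fun n _ => up_log 2 n).
Proof.
exists 1, 1%N => n N n0 N0; rewrite mul1r expr1.
have [n1|n1] := leqP n 1.
  have -> : n = 1%N by apply/eqP; rewrite eqn_leq n1.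
  by rewrite up_log1 addr_ge0 ?log2_ge0.
have : (2 ^ (up_log 2 n).-1 <= n * N)%N.
  by apply: leq_trans (leq_pmulr n N0); rewrite ltnW ?up_log_gtn.
move=> /log2_exp2; have : (0 < up_log 2 n)%N by rewrite up_log_gt0.
by case: (up_log 2 n) => // m _ /= mle; rewrite -natr1 addrC lerD2l.
Qed.

Lemma log2_ge1 n N : (1 < n * N)%N -> 1 <= L n N.
Proof. exact: (@log2_exp2 _ 1). Qed.

Lemma log2_1 : L 1 1 = 0.
Proof. by rewrite /log2 ln1 mul0r. Qed.

Lemma muln_gt0_cases n N : (0 < n)%N -> (0 < N)%N ->
  n = 1%N /\ N = 1%N \/ (1 < n * N)%N.
Proof.
move=> n0 N0; have [/eqP|nN] := eqVneq (n * N)%N 1%N.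
  by rewrite muln_eq1 => /andP[/eqP ? /eqP ?]; left.
by right; rewrite ltn_neqAle eq_sym nN muln_gt0 n0.
Qed.

Lemma Omega_inv_polylog f : (forall n N, 0 < f n N)%N -> @polylog R f ->
  exists2 k : R, 0 <= k & Omega_inv_log k (fun n N => (f n N)%:R^-1).
Proof.
move=> f0 [c [d fle]]; exists d.+1%:R => //; split.
  by move=> n N _ _; rewrite invr_gt0 ltr0n.
have c1 : 0 < (`|c| + 1) * 2 ^+ d by rewrite mulr_gt0 ?exprn_gt0 ?ltr_wpDl.
exists ((`|c| + 1) * 2 ^+ d)^-1; first by rewrite invr_gt0.
move=> n N n0 N0; have [[-> ->]|nN] := muln_gt0_cases n0 N0.
  by rewrite log2_1 powR0 ?pnatr_eq0// invr0 mulr0 invr_ge0 ler0n.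
have L1 := log2_ge1 nN; rewrite powR_mulrn ?log2_ge0// -invfM.
have L0 : 0 < L n N by lra.
rewrite lef_pV2 ?posrE ?ltr0n ?(mulr_gt0 c1) ?exprn_gt0//.
apply: le_trans (fle n N n0 N0) _.
apply: (@le_trans _ _ ((`|c| + 1) * (1 + L n N) ^+ d)).
  apply: ler_wpM2r; first by rewrite exprn_ge0; lra.
  by apply: le_trans (ler_norm c) _; rewrite lerDl.
rewrite -mulrA ler_wpM2l ?addr_ge0//.
apply: (@le_trans _ _ (2 ^+ d * L n N ^+ d)).
  by rewrite -exprMn lerXn2r// ?nnegrE; lra.
by rewrite ler_wpM2l ?exprn_ge0// ler_weXn2l.
Qed.

Lemma polylog_inv (k : R) (eps : nat -> nat -> R) : 0 <= k ->
  Omega_inv_log k eps ->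
  exists f, [/\ forall n N, (0 < f n N)%N, @polylog R f &
    forall n N, (0 < n)%N -> (0 < N)%N -> (f n N)%:R^-1 <= eps n N].
Proof.
move=> k0 [eps0 [c c0 epsle]].
exists (fun n N => (Num.truncn (eps n N)^-1).+1); split => //; last first.
  move=> n N n0 N0; rewrite invf_ple ?posrE ?ltr0n ?eps0//.
  by apply/ltW; rewrite truncnS_gt.
(* [d] is an integer above [k]; [a] covers the single pair [n = N = 1], where the logarithm is 0. *)
pose d := (Num.truncn k).+1; pose a := (eps 1 1)^-1.
have a0 : 0 < a by rewrite invr_gt0 eps0.
exists (c^-1 + a + 1), d => n N n0 N0.
have L0 := log2_ge0 n0 N0; set l := L n N in L0 *.
have X1 : 1 <= (1 + l) ^+ d by rewrite exprn_ege1 // lerDl.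
have eps_inv : (eps n N)^-1 <= (c^-1 + a) * (1 + l) ^+ d.
  have ci0 : 0 < c^-1 by rewrite invr_gt0.
  have [[-> ->]|nN] := muln_gt0_cases n0 N0.
    by rewrite -/a; nra.
  have l1 : 1 <= l by exact: log2_ge1.
  have lk : 0 < l `^ k by rewrite powR_gt0; lra.
  have : (eps n N)^-1 <= c^-1 * l `^ k.
    rewrite -[leRHS]invrK lef_pV2 ?posrE ?invr_gt0 ?mulr_gt0 ?eps0//.
    by rewrite invfM invrK; exact: epsle.
  have : l `^ k <= (1 + l) ^+ d.
    apply: (@le_trans _ _ (l `^ d%:R)).
      by rewrite ler_powR // ltW // truncnS_gt.
    by rewrite powR_mulrn// lerXn2r ?nnegrE//; lra.
  nra.
have : (Num.truncn (eps n N)^-1)%:R <= (eps n N)^-1.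
  by rewrite truncn_le// invr_ge0 ltW// eps0.
rewrite -natr1; nra.
Qed.

End Asymptotics.

Theorem theorem8 (R : realType) (C : R) (tau : nat -> nat -> nat)
    (thresholds : set ((R -> R) -> nat)) :
  (forall (k u : R) (eps delta : nat -> nat -> R), 0 <= k -> 0 <= u ->
     Omega_inv_log k eps -> Omega_inv_log u delta ->
     exists M : forall n N : nat, algorithm n (R -> R) (seq (R * 'I_n)),
       @polylog R (fun n N => memory_bits (M n N)) /\
       exists2 m, thresholds m &
         forall n N : nat, (0 < n)%N -> (0 < N)%N ->
           universal_core_algorithm (tau n N) N (eps n N) (delta n N) 1
             (classU_from C m n N) (M n N)) ->
  forall (k : R) (eps : nat -> nat -> R), 0 <= k -> Omega_inv_log k eps ->
    exists M : forall n N : nat, algorithm n (R -> R) R,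
      @polylog R (fun n N => memory_bits (M n N)) /\
      exists2 m, thresholds m &
        forall n N : nat, (0 < n)%N -> (0 < N)%N ->
          universal_sum_algorithm (tau n N) N (eps n N) (3 / 10)
            (classU_from C m n N) (M n N).
Proof.
move=> core k eps k0 eps_Omega.
have [q [q0 q_polylog q_eps]] := polylog_inv k0 eps_Omega.
(* There are [phi] levels, and [2 ^ phi = 16 * 2 ^ w >= 10 * n]. With [e = 1 / K], [2 ^ b >= K ^ 2]
   and [beta = 2 / K], one has [e ^ 2 + 2 ^ -b <= beta ^ 2] and
   [phi * beta = 1 / (10 * q) <= eps / 10]. [Delta] is ten times the number of copies, for the union
   bound. *)
pose w (n N : nat) := up_log 2 n.
pose phi n N := (w n N + 4)%N.
pose K n N := (20 * phi n N * q n N)%N.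
pose b n N := up_log 2 (K n N * K n N).
pose Delta n N := (10 * (phi n N * 2 ^ b n N))%N.
have phi0 n N : (0 < phi n N)%N by rewrite addn_gt0 orbT.
have phiE n N : (w n N + 3).+1 = phi n N by rewrite -addnS.
have K0 n N : (1 < K n N)%N.
  by apply: (@leq_trans (20 * 1 * 1)) => //; rewrite !leq_mul.
have w_polylog : @polylog R w by exact: polylog_up_log.
have phi_polylog : @polylog R phi by apply: polylogD => //; exact: polylog_cst.
have K_polylog : @polylog R K.
  by apply: polylogM => //; apply: polylogM => //; exact: polylog_cst.
(* There is one copy per bucket, so [2 ^ b] itself must be polylogarithmic; rounding up costs at
   most a factor 2 over [K ^ 2]. *)
have B_polylog : @polylog R (fun n N => 2 ^ b n N)%N.
  apply: (@polylog_le _ _ (fun n N => 2 * (K n N * K n N))%N).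
    move=> n N _ _; have KK : (1 < K n N * K n N)%N.
      by rewrite (@leq_mul 2 1)// ltnW.
    rewrite /b; have := @up_log_gtn 2 _ isT KK.
    have : (0 < up_log 2 (K n N * K n N))%N by rewrite up_log_gt0.
    case: (up_log 2 _) => // d _ /= /ltnW; by rewrite expnS leq_mul2l.
  by apply: polylogM; [exact: polylog_cst|exact: polylogM].
have b_polylog : @polylog R b.
  by apply: polylog_le B_polylog => n N _ _; apply/ltnW/ltn_expl.
have Delta_polylog : @polylog R Delta.
  by apply: polylogM; [exact: polylog_cst|exact: polylogM].
have Delta0 n N : (0 < Delta n N)%N by rewrite !muln_gt0 phi0 expn_gt0.
have [k1 k1_ge0 e_Omega] :=
  Omega_inv_polylog (fun n N => ltnW (K0 n N)) K_polylog.
have [u u_ge0 delta_Omega] := Omega_inv_polylog Delta0 Delta_polylog.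
have [M [M_polylog [m m_thr M_core]]] :=
  core _ _ _ _ k1_ge0 u_ge0 e_Omega delta_Omega.
exists (fun n N => sketch (w n N) (b n N) (w n N + 3) (M n N)); split.
  apply: (@polylog_le _ _ (fun n N => (w n N + 1) * (b n N + 1) * phi n N +
    memory_bits (M n N) * (phi n N * 2 ^ b n N))%N).
    move=> n N _ _; rewrite !addn1 -phiE; exact: memory_sketch.
  have one_polylog := polylog_cst R 1.
  apply: polylogD; last by apply: polylogM => //; exact: polylogM.
  by apply: polylogM => //; apply: polylogM; exact: polylogD.
(* The argument treats each [G] separately, so the threshold of the core algorithm carries over
   unchanged. *)
exists m => // n N n0 N0.
have KR0 : 0 < (K n N)%:R :> R by rewrite ltr0n ltnW.
apply: (sketch_correct (e := (K n N)%:R^-1) (beta := 2 / (K n N)%:R)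
  (delta := (Delta n N)%:R^-1)).
- by move=> G [[G_homo [G0 _]] _].
- exact: M_core.
- exact: up_logP.
- rewrite phiE /phi expnD mulnC; apply: leq_mul => //; exact: up_logP.
- exact: ltW (eps_Omega.1 n N n0 N0).
- by rewrite invr_ge0 ltW.
- by rewrite divr_gt0.
- have : (2 ^+ b n N)^-1 <= (K n N)%:R^-1 ^+ 2 :> R.
    rewrite exprVn lef_pV2 ?posrE ?exprn_gt0// expr2 -natrM -natrX ler_nat.
    exact: up_logP.
  rewrite exprMn; have := sqr_ge0 ((K n N)%:R^-1 : R); lra.
- apply: le_trans (_ : _ <= (q n N)%:R^-1 / 10) _; last first.
    by have := q_eps n N n0 N0; lra.
  rewrite phiE /K !natrM !invfM.
  have : (phi n N)%:R * (phi n N)%:R^-1 = 1 :> R.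
    by rewrite divff// pnatr_eq0 -lt0n.
  set x := _%:R; set y := x^-1; set z := (q n N)%:R^-1 => xy1.
  have -> : x * (2 * (20^-1 * y * z)) = x * y * (z / 10) by lra.
  by rewrite xy1 mul1r.
- rewrite phiE /Delta [(10 * _)%:R]natrM invfM mulrCA divff ?mulr1 ?div1r//.
  by rewrite pnatr_eq0 -lt0n muln_gt0 phi0 expn_gt0.
Qed.
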